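(* Assume $\mathcal H_z(\overline z_k)$ and $\psi_z(\overline z_k)$ are linearly independent for $k=0,\dots,N-1$. A regularized DTH trajectory must satisfy the following equations and inequalities for $k=0,\dots,N-1$: \[ \Delta z_k=\lambda_k J\mathcal H_z(\overline z_k)+\mu_k J\psi_z(\overline z_k), \] \[ \mathcal H(\overline z_k)=0, \] \[ \psi(\overline z_k)\ge\psi_k\quad(\text{or }\psi(\overline z_k)\le\psi_k), \] \[ \mu_k\,(\psi(\overline z_k)-\psi_k)=0, \] \[ \mu_k\le 0\quad(\text{or }\mu_k\ge 0). \] Here $\lambda_k$ is a Lagrange multiplier for the equality constraint $\mathcal H(\overline z_k)=0$ and $\mu_k$ is a Karush-Kuhn-Tucker multiplier for the inequality constraint $\psi(\overline z_k)\ge\psi_k$ (or $\psi(\overline z_k)\le\psi_k$); the alternatives in parentheses go together.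
   Context: Consider an $n$-degree of freedom Hamiltonian dynamical system with Hamiltonian function $H(t,q_1,\dots,q_n,p_1,\dots,p_n)$, where $t$ is time and $q_i,p_i$ are position and momentum coordinates. Extended phase space coordinates are $q=(q_1,\dots,q_n,t)^\top$, $p=(p_1,\dots,p_n,\wp)^\top$, where $\wp$ is the momentum conjugate to time, and $z=(q,p)^\top$. The extended-phase space Hamiltonian function is $\mathcal H(z)=\wp+H(t,q_1,\dots,q_n,p_1,\dots,p_n)$. $J=\begin{pmatrix}0&I\\-I&0\end{pmatrix}$ with $I$ the $(n+1)$-dimensional identity matrix; subscripts $z$ and $zz$ denote gradient and Hessian, and $\psi(z)=(J\mathcal H_z)^\top\mathcal H_{zz}(J\mathcal H_z)$. The $\psi_k$ are constants. Trajectories are piecewise-linear and continuous in extended phase space, with vertices $z_k=(q_k,p_k)^\top$, $k=0,\dots,N$. Write $\Delta z_k=z_{k+1}-z_k$, $\Delta q_k=q_{k+1}-q_k$, $\Delta p_k=p_{k+1}-p_k$ and $\overline z_k=\frac12(z_{k+1}+z_k)$. The one-step action is $\mathcal A(z_k,z_{k+1})=\frac12\Delta q_k^\top\Delta p_k$. Regularized DTH (discrete-time Hamiltonian) principle, which defines a regularized DTH trajectory: the one-step action $\mathcal A(z_k,z_{k+1})$, $k=0,\dots,N-1$, is stationary along the trajectory for variations which fix $q_k$ and $p_{k+1}$ and satisfy the Hamiltonian constraint $\mathcal H(\overline z_k)=0$ and the inequality constraint $\psi(\overline z_k)\ge\psi_k$ (or $\psi(\overline z_k)\le\psi_k$). 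*)

(* Defs.v *)
(* MathComp-Analysis, over an arbitrary R : realType. *)
From HB Require Import structures.
From mathcomp Require Import all_boot all_order all_algebra.
From mathcomp Require Import boolp classical_sets functions reals.
From mathcomp Require Import topology normedtype derive.

Set Implicit Arguments.
Unset Strict Implicit.
Unset Printing Implicit Defensive.

Import Order.TTheory GRing.Theory Num.Theory.
Import numFieldNormedType.Exports.

Local Open Scope classical_set_scope.
Local Open Scope ring_scope.

Section Calculus.
Context {R : realType} {m : nat}.
Implicit Types (f : 'cV[R]_m -> R) (z : 'cV[R]_m) (U : set 'cV[R]_m).

Definition grad f z : 'cV[R]_m := \col_i 'D_(delta_mx i 0) f z.

Definition hess f z : 'M[R]_m :=
  \matrix_(i, j) 'D_(delta_mx i 0) (fun w => 'D_(delta_mx j 0) f w) z.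

(* f is k times continuously differentiable on U; meant for open U. *)
Fixpoint Ck_on (k : nat) U f : Prop :=
  match k with
  | 0%N => forall z, U z -> {for z, continuous f}
  | k'.+1 => (forall z, U z -> differentiable f z) /\
             (forall v : 'cV[R]_m, Ck_on k' U (fun z => 'D_v f z))
  end.

End Calculus.

Section PhaseSpace.
Context {R : realType} {n : nat}.

(* Extended phase space: z = col_mx q p, with
   q = (q_1, ..., q_n, t) and p = (p_1, ..., p_n, wp). *)
Local Notation config := 'cV[R]_(n + 1).
Local Notation phase := 'cV[R]_((n + 1) + (n + 1)).

Definition Jmx : 'M[R]_((n + 1) + (n + 1)) :=
  block_mx 0 1%:M (- 1%:M) 0.

Variable H : R -> 'cV[R]_n -> 'cV[R]_n -> R.

Definition extH (z : phase) : R :=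
  let q := usubmx z in
  let p := dsubmx z in
  dsubmx p 0 0 + H (dsubmx q 0 0) (usubmx q) (usubmx p).

Definition psi (z : phase) : R :=
  ((Jmx *m grad extH z)^T *m hess extH z *m (Jmx *m grad extH z)) 0 0.

Definition midpoint (z z' : phase) : phase := 2^-1 *: (z' + z).

Definition action (z z' : phase) : R :=
  2^-1 * ((usubmx z' - usubmx z)^T *m (dsubmx z' - dsubmx z)) 0 0.

(* AtLeast is the constraint psi >= c, AtMost the constraint psi <= c. *)
Variant sense := AtLeast | AtMost.

Definition bound (s : sense) (x c : R) : Prop :=
  match s with AtLeast => c <= x | AtMost => x <= c end.

Definition multiplier_sign (s : sense) (mu : R) : Prop :=
  match s with AtLeast => mu <= 0 | AtMost => 0 <= mu end.

Definition admissible (s : sense) (c : R) (z z' : phase) : Prop :=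
  extH (midpoint z z') = 0 /\ bound s (psi (midpoint z z')) c.

(* A variation of the step (z, z') moves the initial momentum and the final
   position along a curve e |-> (P e, Q e), keeping the initial position and
   the final momentum fixed.  Because of the inequality constraint, admissible
   variations are in general one-sided: the constraints are imposed for small
   e > 0 only, and stationarity means that the first variation of the action is
   nonnegative (the first-order condition of the Karush-Kuhn-Tucker theory, with
   the orientation of a minimum).  For a variation which is admissible for small e of both signs,
   reversing e shows that the first variation vanishes. *)
Definition stationary_step (s : sense) (c : R) (z z' : phase) : Prop :=
  forall P Q : R -> config,
    P 0 = dsubmx z -> Q 0 = usubmx z' ->
    derivable P 0 1 -> derivable Q 0 1 ->
    (\forall e \near 0^'+,
       admissible s c (col_mx (usubmx z) (P e)) (col_mx (Q e) (dsubmx z'))) ->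
    0 <= 'D_1 (fun e : R => action (col_mx (usubmx z) (P e))
                                   (col_mx (Q e) (dsubmx z'))) 0.

(* A piecewise-linear continuous trajectory is given by its vertices
   z 0, ..., z N; the values of z, s and c beyond these are irrelevant. *)
Definition regularized_DTH (N : nat) (s : nat -> sense) (c : nat -> R)
    (z : nat -> phase) : Prop :=
  forall k : nat, (k < N)%N ->
    admissible (s k) (c k) (z k) (z k.+1) /\
    stationary_step (s k) (c k) (z k) (z k.+1).

End PhaseSpace.

(* Main.v *)
Require Import Defs.
From mathcomp Require Import all_boot all_order all_algebra.
From mathcomp Require Import ring lra.
From mathcomp Require Import boolp classical_sets functions reals.
From mathcomp Require Import topology normedtype landau derive.
Import Order.TTheory GRing.Theory Num.Theory.
Import numFieldNormedType.Exports.
Local Open Scope classical_set_scope.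
Local Open Scope ring_scope.

(* A variation fixing q_k and p_{k+1} amounts to a free variation w of the
   midpoint, and the first variation of the action is then the scalar product
   of J (Delta z_k) with w'.  Every direction v orthogonal to the gradient of
   the Hamiltonian is the velocity of a curve on its zero level set, and this
   curve satisfies the inequality constraint as soon as that constraint is
   inactive or strictly improving along v.  Hence J (Delta z_k) has nonnegative
   product with all such v, which by orthogonal projection makes it a
   combination of the two gradients with the right sign; applying -J gives the
   equations. *)

(** * Scalar products and multiplier rules in linear algebra *)

Definition dot {R : comPzRingType} {m : nat} (u v : 'cV[R]_m) : R :=
  \sum_i u i 0 * v i 0.

Lemma dotC {R : comPzRingType} {m : nat} (u v : 'cV[R]_m) : dot u v = dot v u.
Proof. by apply: eq_bigr => i _; rewrite mulrC. Qed.

Lemma dotDr {R : comPzRingType} {m : nat} (u v w : 'cV[R]_m) :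
  dot u (v + w) = dot u v + dot u w.
Proof. by rewrite -big_split; apply: eq_bigr => i _; rewrite mxE mulrDr. Qed.

Lemma dotZr {R : comPzRingType} {m : nat} (k : R) (u v : 'cV[R]_m) :
  dot u (k *: v) = k * dot u v.
Proof. by rewrite mulr_sumr; apply: eq_bigr => i _; rewrite mxE mulrCA. Qed.

Lemma dotDl {R : comPzRingType} {m : nat} (u v w : 'cV[R]_m) :
  dot (u + v) w = dot u w + dot v w.
Proof. by rewrite ![dot _ w]dotC dotDr. Qed.

Lemma dotZl {R : comPzRingType} {m : nat} (k : R) (u v : 'cV[R]_m) :
  dot (k *: u) v = k * dot u v.
Proof. by rewrite ![dot _ v]dotC dotZr. Qed.

Lemma dot_ge0 {R : realDomainType} {m : nat} (u : 'cV[R]_m) : 0 <= dot u u.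
Proof. by apply: sumr_ge0 => i _; rewrite -expr2 sqr_ge0. Qed.

Lemma dot_eq0 {R : realDomainType} {m : nat} (u : 'cV[R]_m) :
  (dot u u == 0) = (u == 0).
Proof.
rewrite psumr_eq0 => [|i _]; last by rewrite -expr2 sqr_ge0.
apply/allP/eqP => [u0|-> i _]; last by rewrite mxE mulr0 eqxx implybT.
apply/colP => i; rewrite mxE; apply/eqP.
by move: (u0 i (mem_index_enum i)); rewrite /= mulf_eq0 orbb.
Qed.

Lemma dot_gt0 {R : realDomainType} {m : nat} (u : 'cV[R]_m) :
  (0 < dot u u) = (u != 0).
Proof. by rewrite lt0r dot_ge0 andbT dot_eq0. Qed.

Lemma dotBZl {R : comPzRingType} {m : nat} (k : R) (u v w : 'cV[R]_m) :
  dot u w = 0 -> dot (v - k *: u) w = dot v w.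
Proof. by move=> uw; rewrite -scaleNr dotDl dotZl uw mulr0 addr0. Qed.

Lemma dot_reject {F : realFieldType} {m : nat} (u v : 'cV[F]_m) :
  u != 0 -> dot u (v - (dot u v / dot u u) *: u) = 0.
Proof.
by rewrite -dot_eq0 => u0; rewrite -scaleNr dotDr dotZr mulNr divfK// subrr.
Qed.

(** Testing on [- r], where [r] is the component of [a] orthogonal to [x], gives [0 <= - dot r r],
    so [r] vanishes. *)
Lemma dot_multiplier {R : realFieldType} {m : nat} (a x : 'cV[R]_m) :
  x != 0 -> (forall v, dot x v = 0 -> 0 <= dot a v) ->
  exists alpha, a = alpha *: x.
Proof.
move=> x0 av; exists (dot x a / dot x x); apply/subr0_eq/eqP.
have := dot_reject x a x0; set k := _ / _; set r := a - k *: x => xr.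
rewrite -dot_eq0 eq_le dot_ge0 andbT [dot r r]dotBZl//.
by rewrite -oppr_ge0 -mulN1r -dotZr av// dotZr xr mulr0.
Qed.

(** A Farkas-type rule. Only strictly improving [v] are tested, since tangency to an active
    inequality constraint does not by itself yield an admissible curve. The multiplier [b] is the
    coefficient of [a] along the part [y'] of [y] orthogonal to [x]; what remains, [a - b *: y'],
    falls under [dot_multiplier]. *)
Lemma dot_multipliers {R : realFieldType} {m : nat} (a x y : 'cV[R]_m) :
  x != 0 -> y \notin <[x]>%VS ->
  (forall v, dot x v = 0 -> 0 < dot y v -> 0 <= dot a v) ->
  exists alpha beta, a = alpha *: x + beta *: y /\ 0 <= beta.
Proof.
move=> x0 yx av.
have := dot_reject x y x0; set k := _ / _; set y' := y - k *: x => xy'.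
have y'0 : y' != 0.
  by apply: contraNneq yx => /subr0_eq ->; apply/vlineP; eexists.
have yy0 : dot y' y' != 0 by rewrite dot_eq0.
have yy' : dot y y' = dot y' y' by rewrite [RHS]dotBZl.
pose b := dot a y' / dot y' y'.
have b0 : 0 <= b.
  by apply: divr_ge0; rewrite ?dot_ge0// av// yy' dot_gt0.
have [|alpha aE] := @dot_multiplier R m (a - b *: y') x x0.
  (* Removing the y'-component of v makes it tangent to both constraints; a
     small multiple of y' then makes it strictly feasible. *)
  move=> v xv; rewrite -scaleNr dotDl dotZl mulNr; apply/ler_addgt0Pr => e e0.
  (* [c] makes the product of [y] with [v + c *: y'] equal to [t], and [t] keeps the error [b * t]
     below [e]; the [+ 1] covers [b = 0]. *)
  pose t := e / (b + 1); have b10 : 0 < b + 1 by rewrite ltr_wpDl.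
  have t0 : 0 < t by rewrite divr_gt0.
  pose c := (t - dot y' v) / dot y' y'.
  have yv : dot y v = dot y' v by rewrite [RHS]dotBZl.
  have cE : c * dot y' y' = t - dot y' v by rewrite /c divfK.
  have bE : dot a y' = b * dot y' y' by rewrite /b divfK.
  have := av (v + c *: y').
  rewrite !dotDr !dotZr xv xy' yy' yv mulr0 addr0 cE addrC subrK.
  move=> /(_ erefl t0); rewrite bE mulrCA cE mulrBr.
  have : b * t <= e.
    by rewrite /t mulrCA ler_piMr ?(ltW e0)// ler_pdivrMr// mul1r lerDl.
  lra.
exists (alpha - b * k), b; split=> //.
move/(canRL (subrK _)): aE => ->; rewrite /y' scalerBr scalerA scalerBl.
by rewrite -!addrA [- _ + _]addrC.
Qed.

(** * First-order expansions and curves on a level set *)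

Lemma grad_dot {R : realType} {m : nat} (f : 'cV[R]_m -> R) (z v : 'cV[R]_m) :
  differentiable f z -> 'D_v f z = dot (grad f z) v.
Proof.
move=> df; rewrite deriveE//.
have -> : v = \sum_i v i 0 *: delta_mx i 0.
  by rewrite {1}[v]matrix_sum_delta; apply: eq_bigr => i _; rewrite big_ord1.
rewrite linear_sum/= [in RHS]/dot; apply: eq_bigr => i _.
rewrite linearZ/= mxE deriveE// summxE (bigD1 i)//= big1 => [|j ji].
  by rewrite !mxE !eqxx mulr1 addr0 mulrC.
by rewrite !mxE (negbTE (_ : i != j)) ?mulr0// eq_sym.
Qed.

Lemma near0_diff {R : realType} {V : normedModType R} (f : V -> R) (z : V) :
  differentiable f z -> forall eps : R, 0 < eps ->
  \forall x \near 0, `|f (x + z) - f z - 'D_x f z| <= eps * `|x|.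
Proof.
move=> df eps e0; have /eqaddoP/(_ eps e0) := diff_locally df.
by apply: filterS => x /=; rewrite deriveE// opprD addrA.
Qed.

(** The norm of [e *: v + t *: u] is at most [e * (|v| + |u|)], so one bound on [e] serves all [t]
    at once. *)
Lemma near_right0_ball {R : realType} {V : normedModType R} (v u : V)
    (P : V -> Prop) :
  (\forall x \near 0, P x) ->
  \forall e \near (0 : R)^'+, forall t : R, `|t| <= e -> P (e *: v + t *: u).
Proof.
case/nbhs_norm0P => r /= r0 rP.
pose C : R := `|v| + `|u| + 1.
have C0 : 0 < C by rewrite /C ltr_wpDl// addr_ge0.
near=> e => t te; apply: rP => /=.
have e0 : 0 < e by [].
apply: le_lt_trans (ler_normD _ _) _; rewrite !normrZ (gtr0_norm e0).
apply: (@le_lt_trans _ _ (e * `|v| + e * `|u|)).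
  by rewrite lerD2l ler_wpM2r.
rewrite -mulrDr; apply: (@lt_trans _ _ (e * C)).
  by rewrite ltr_pM2l// /C ltrDl.
rewrite -ltr_pdivlMr//; near: e; apply: nbhs_right_lt.
by rewrite divr_gt0.
Unshelve. all: by end_near. Qed.

(** Uniformity in [t] lets the estimate be used at the endpoints [- e] and [e] as well as at a zero
    whose position is unknown. *)
Lemma near_right0_diff {R : realType} {V : normedModType R} (f : V -> R)
    (z v u : V) :
  differentiable f z -> 'D_v f z = 0 -> forall eps : R, 0 < eps ->
  \forall e \near (0 : R)^'+, forall t : R, `|t| <= e ->
    `|f (e *: v + t *: u + z) - f z - t * 'D_u f z| <= eps * e.
Proof.
move=> df v0 eps eps0.
pose C : R := `|v| + `|u| + 1.
have C0 : 0 < C by rewrite /C ltr_wpDl// addr_ge0.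
have e0 : 0 < eps / C by rewrite divr_gt0.
have := near_right0_ball v u _ (near0_diff f z df (eps / C) e0).
move=> H; near=> e; have ep : 0 < e by [].
move=> t te; have : `|f (e *: v + t *: u + z) - f z - 'D_(e *: v + t *: u) f z|
  <= eps / C * `|e *: v + t *: u| by move: t te; near: e.
have -> : 'D_(e *: v + t *: u) f z = t * 'D_u f z.
  by rewrite !deriveE// linearD !linearZ/= -!deriveE// v0 scaler0 add0r.
move=> /le_trans; apply.
rewrite -mulrA ler_pM2l// ler_pdivrMl//.
apply: le_trans (ler_normD _ _) _; rewrite !normrZ (gtr0_norm ep) !mulrDl.
have : `|t| * `|u| <= e * `|u| by rewrite ler_wpM2r.
lra.
Unshelve. all: by end_near. Qed.

(** At [t = e] and [t = - e] the term [t * 'D_u f z] exceeds the error, which is at most half its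
    size, so [f - f z] changes sign and the intermediate value theorem applies. *)
Lemma level_zero {R : realType} {V : normedModType R} (f : V -> R)
    (z v u : V) :
  (\forall w \near z, {for w, continuous f}) -> differentiable f z ->
  'D_v f z = 0 -> 0 < 'D_u f z ->
  \forall e \near (0 : R)^'+,
    exists2 t : R, `|t| <= e & f (e *: v + t *: u + z) = f z.
Proof.
move=> cf df v0 u0; have d20 : 0 < 'D_u f z / 2 by rewrite divr_gt0.
have D := near_right0_diff f z v u df v0 _ d20.
have {}cf : \forall e \near (0 : R)^'+, forall t : R, `|t| <= e ->
    {for e *: v + t *: u + z, continuous f}.
  apply: (near_right0_ball v u (fun x => {for x + z, continuous f})).
  by move/nbhs0P: cf; apply: filterS => x; rewrite addrC.
near=> e; have e0 : 0 < e by [].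
have De : forall t : R, `|t| <= e ->
    `|f (e *: v + t *: u + z) - f z - t * 'D_u f z| <= 'D_u f z / 2 * e.
  by near: e.
have ce : forall t : R, `|t| <= e -> {for e *: v + t *: u + z, continuous f}.
  by near: e.
have [|||t] := @IVT R (fun t => f (e *: v + t *: u + z)) (- e) e (f z).
- by rewrite ge0_cp// ltW.
- apply: continuous_in_subspaceT => t /set_mem/=; rewrite in_itv/= -ler_norml.
  move=> te; have/ce cft := te.
  apply: (cvg_comp (fun t => e *: v + t *: u + z) f _ cft).
  apply: cvgD; last exact: cvg_cst.
  by apply: cvgD; [exact: cvg_cst|exact: scalel_continuous].
- have := De e; rewrite (gtr0_norm e0) => /(_ (lexx _)).
  have := De (- e); rewrite normrN (gtr0_norm e0) => /(_ (lexx _)).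
  rewrite ge_min le_max !ler_norml => /andP[_ A] /andP[B _].
  have dp : 0 < 'D_u f z * e by rewrite mulr_gt0.
  by apply/andP; split; apply/orP; [left|right]; lra.
- by rewrite in_itv/= -ler_norml => te fE; exists t.
Unshelve. all: by end_near. Qed.

(** The zeros given by [level_zero] are picked by choice, with no continuity in [e]: the curve only
    needs a velocity at 0. *)
Lemma level_curve {R : realType} {V : normedModType R} (f : V -> R)
    (z v u : V) :
  (\forall w \near z, {for w, continuous f}) -> differentiable f z ->
  'D_v f z = 0 -> 0 < 'D_u f z ->
  exists w : R -> V, [/\ w 0 = z, is_derive (0 : R) 1 w v
    & \forall e \near 0^'+, f (w e) = f z].
Proof.
move=> cf df v0 u0.
have Z := level_zero f z v u cf df v0 u0.
pose Q e t := `|t| <= e /\ f (e *: v + t *: u + z) = f z.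
(* The default value 0 is taken for [e <= 0] and wherever no zero exists. The first clause controls
   [tau] at every [e], which gives its derivative at 0; the second puts the curve on the level set
   for small [e > 0]. *)
have /choice[tau tauP] : forall e, exists t,
    (t = 0 \/ 0 < e /\ Q e t) /\ (0 < e -> (exists t', Q e t') -> Q e t).
  move=> e; have [[e0 [t Qt]]|nQ] := pselect (0 < e /\ exists t, Q e t).
    by exists t; split; [right|].
  by exists 0; split=> [|e0 Qe]; [left|case: nQ].
have tau0 : tau 0 = 0 by have [[|[]]] := tauP 0; rewrite ?ltxx.
(* Any zero t of e |-> f (z + e v + t u) - f z with |t| <= e is o(e), because
   f (z + e v + t u) - f z = t 'D_u f z + o(e). *)
have dtau : is_derive (0 : R) 1 tau 0.
  have cv : (fun h : R => h^-1 *: ((tau \o shift 0) (h *: (1 : R)) - tau 0))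
      @ 0^' --> 0.
    apply/cvgr0Pnorm_le => eps eps0.
    have De : 0 < eps * 'D_u f z by rewrite mulr_gt0.
    have D := nbhs_dnbhs (near_right0_diff f z v u df v0 _ De).
    near=> h; rewrite /= addr0 tau0 subr0 [h *: 1]mulr1 normrZ normfV.
    have [[->|[h0 [th fh]]] _] := tauP h; first by rewrite normr0 mulr0 ltW.
    rewrite (gtr0_norm h0) ler_pdivrMl// -(ler_pM2r u0).
    have : 0 < h -> forall t : R, `|t| <= h ->
      `|f (h *: v + t *: u + z) - f z - t * 'D_u f z| <= eps * 'D_u f z * h.
      by near: h; exact: D.
    move=> /(_ h0 _ th); rewrite fh subrr sub0r normrN normrM (gtr0_norm u0).
    by rewrite mulrAC [eps * h]mulrC.
  by apply: DeriveDef; [apply/cvg_ex; exists 0|exact/cvg_lim].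
exists (fun e => e *: v + tau e *: u + z); split.
- by rewrite tau0 !scale0r !add0r.
- have /derivable1_diffP/differentiableP dt : derivable tau 0 1 by [].
  have dw := is_diffD (is_diffD (is_diff_scalel (0 : R) v)
    (is_diff_comp dt (is_diff_scalel _ u))) (is_diff_cst z 0).
  have [ew dwE] := dw.
  apply: DeriveDef; first exact/derivable1_diffP/ew.
  rewrite deriveE; last exact: ew.
  rewrite dwE !fctE /= scale1r -deriveE//.
  by rewrite derive_val scale0r !addr0.
- near=> e; have e0 : 0 < e by [].
  have [t te fe] : exists2 t : R, `|t| <= e & f (e *: v + t *: u + z) = f z.
    by near: e.
  by apply: ((tauP e).2 e0 _).2; exists t.
Unshelve. all: by end_near. Qed.

Lemma near_right0_gt {R : realType} (phi : R -> R) :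
  derivable phi 0 1 -> 0 < 'D_1 phi 0 ->
  \forall e \near 0^'+, phi 0 < phi e.
Proof.
move=> dphi d0; have /derivable1_diffP dfphi := dphi.
have d20 : 0 < 'D_1 phi 0 / 2 by rewrite divr_gt0.
have := near0_diff phi 0 dfphi _ d20 => H.
near=> e; have e0 : 0 < e by [].
have : `|phi (e + 0) - phi 0 - 'D_e phi 0| <= 'D_1 phi 0 / 2 * `|e|.
  by near: e; exact: cvg_within H.
have -> : 'D_e phi 0 = e * 'D_1 phi 0.
  by rewrite !deriveE// -{1}[e]mulr1 linearZ.
rewrite addr0 (gtr0_norm e0) ler_norml => /andP[].
have : 0 < e * 'D_1 phi 0 by rewrite mulr_gt0.
lra.
Unshelve. all: by end_near. Qed.

(** * Karush-Kuhn-Tucker conditions for one equality and one inequality *)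

Lemma kkt {R : realType} {m : nat} (f g : 'cV[R]_m -> R) (z a : 'cV[R]_m)
    (c : R) :
  (\forall w \near z, {for w, continuous f}) ->
  differentiable f z -> differentiable g z ->
  grad f z != 0 -> grad g z \notin <[grad f z]>%VS -> c <= g z ->
  (forall w : R -> 'cV[R]_m, w 0 = z -> derivable w 0 1 ->
    (\forall e \near 0^'+, f (w e) = f z /\ c <= g (w e)) ->
    0 <= dot a ('D_1 w 0)) ->
  exists alpha beta, [/\ a = alpha *: grad f z + beta *: grad g z,
    beta * (g z - c) = 0 & 0 <= beta].
Proof.
move=> cf df dg f0 fg cg aP.
have av v : dot (grad f z) v = 0 -> c < g z \/ 0 < dot (grad g z) v ->
    0 <= dot a v.
  move=> fv gv; have [] := level_curve f z v (grad f z) cf df.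
  - by rewrite grad_dot.
  - by rewrite grad_dot// dot_gt0.
  move=> w [w0 dw wf]; have dw' : derivable w 0 1 by [].
  have /derivable1_diffP diffw := dw'.
  have dgw : differentiable (g \o w) 0.
    by apply: differentiable_comp; rewrite ?w0.
  rewrite -(@derive_val _ _ _ _ _ _ _ dw) aP//.
  have wg : \forall e \near 0^'+, c <= g (w e).
    (* An inactive constraint persists along [w] by continuity; otherwise [g \o w] has a positive
       derivative at 0 and so increases just after it. *)
    case: gv => [cgz|gv].
      have : g (w e) @[e --> (0 : R)^'+] --> g z.
        rewrite -w0; apply: cvg_at_right_filter.
        exact: differentiable_continuous dgw.
      move=> /cvgr_gt/(_ _ cgz).
      by apply: filterS => e /ltW.
    have D : 'D_1 (g \o w) 0 = dot (grad g z) v.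
      rewrite deriveE// diff_comp//= ?w0// -!deriveE// ?grad_dot// -?w0//.
      by rewrite derive_val.
    have/near_right0_gt : derivable (g \o w) 0 1 by exact: diff_derivable.
    rewrite D /= w0 => /(_ gv).
    by apply: filterS => e /ltW; apply: le_trans.
  by near=> e; split; near: e.
(* In the inactive case every direction tangent to the level set is tested and [beta = 0]; in the
   active case [g z = c], which gives complementarity. *)
have [cgz|gc] := ltP c (g z).
  have [|alpha ->] := @dot_multiplier R m a (grad f z) f0.
    by move=> v fv; apply: av => //; left.
  by exists alpha, 0; rewrite scale0r addr0 mul0r.
have [|alpha [beta [-> b0]]] :=
    @dot_multipliers R m a (grad f z) (grad g z) f0 fg.
  by move=> v fv gv; apply: av => //; right.
exists alpha, beta; split=> //.
by rewrite (@le_anti _ _ (g z) c) ?subrr ?mulr0// gc.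
Unshelve. all: by end_near. Qed.

(** * Differentiability of [psi] *)

Lemma differentiable_bigsum {R : realType} {V : normedModType R} (n : nat)
    (F : 'I_n -> V -> R) (z : V) :
  (forall i, differentiable (F i) z) ->
  differentiable (fun w => \sum_i F i w) z.
Proof.
move=> dF; have -> : (fun w => \sum_i F i w) = \sum_i F i.
  by apply/funext => w; rewrite fct_sumE.
exact: differentiable_sum.
Qed.

(** [psi] is a polynomial in the first and second partial derivatives of [extH H], and third-order
    smoothness makes each of these differentiable. *)
Lemma differentiable_psi {R : realType} {n : nat}
    (H : R -> 'cV[R]_n -> 'cV[R]_n -> R)
    (U : set 'cV[R]_((n + 1) + (n + 1))) (z : 'cV[R]_((n + 1) + (n + 1))) :
  Ck_on 3 U (extH H) -> U z -> differentiable (psi H) z.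
Proof.
move=> [_ C2] Uz.
have dgrad i : differentiable (fun w => grad (extH H) w i 0) z.
  under eq_fun do rewrite mxE.
  by have [/(_ z Uz)] := C2 (delta_mx i 0).
have dhess i j : differentiable (fun w => hess (extH H) w i j) z.
  under eq_fun do rewrite mxE.
  by have [_ /(_ (delta_mx i 0))[/(_ z Uz)]] := C2 (delta_mx j 0).
have dJ i : differentiable (fun w => (Jmx *m grad (extH H) w) i 0) z.
  under eq_fun do rewrite mxE.
  apply: differentiable_bigsum => j.
  exact: (differentiableM (differentiable_cst _ _)).
rewrite /psi; under eq_fun do rewrite mxE.
apply: differentiable_bigsum => j; apply: differentiableM => //.
under eq_fun do rewrite mxE.
apply: differentiable_bigsum => i; apply: differentiableM => //.
by under eq_fun do rewrite mxE.
Qed.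

(** * Variations of one step, seen from its midpoint *)

Lemma is_derive_coord {R : realType} {m : nat} (w : R -> 'cV[R]_m) (t : R)
    (i : 'I_m) :
  derivable w t 1 -> is_derive t 1 (fun e => w e i 0) ('D_1 w t i 0).
Proof.
move=> dw; rewrite derive_mx// mxE; apply: DeriveDef => //.
exact: ((derivable_mxP _ _ _).1 dw).
Qed.

Lemma gradN {R : realType} {m : nat} (g : 'cV[R]_m -> R) (z : 'cV[R]_m) :
  differentiable g z -> grad (- g) z = - grad g z.
Proof.
move=> dg; apply/colP => i; rewrite !mxE deriveN//.
exact: diff_derivable.
Qed.

(* J (z' - z): the differential of the action as a function of the midpoint,
   for fixed initial position and final momentum. *)
Definition action_covector {R : realType} {n : nat}
    (z z' : 'cV[R]_((n + 1) + (n + 1))) : 'cV[R]_((n + 1) + (n + 1)) :=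
  col_mx (dsubmx (z' - z)) (- usubmx (z' - z)).

(** [Jmx] squares to minus the identity; this turns a multiplier formula for the covector into one
    for the step. *)
Lemma Jmx_action_covector {R : realType} {n : nat}
    (z z' : 'cV[R]_((n + 1) + (n + 1))) :
  Jmx *m action_covector z z' = - (z' - z).
Proof.
rewrite /Jmx /action_covector mul_block_col !mul0mx add0r addr0 mulNmx !mul1mx.
by rewrite -opp_col_mx vsubmxK.
Qed.

(* A variation fixing the initial position and the final momentum is determined
   by the curve w of its midpoints. *)
Lemma stationary_midpoint {R : realType} {n : nat}
    (H : R -> 'cV[R]_n -> 'cV[R]_n -> R) (s : sense) (c : R)
    (z z' : 'cV[R]_((n + 1) + (n + 1))) (w : R -> 'cV[R]_((n + 1) + (n + 1))) :
  stationary_step H s c z z' -> w 0 = midpoint z z' -> derivable w 0 1 ->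
  (\forall e \near 0^'+, extH H (w e) = 0 /\ bound s (psi H (w e)) c) ->
  0 <= dot (action_covector z z') ('D_1 w 0).
Proof.
move=> st w0 dw wadm.
(* [P] and [Q] solve the midpoint equation for the two free halves, the other two being fixed. *)
pose P e := 2 *: dsubmx (w e) - dsubmx z'.
pose Q e := 2 *: usubmx (w e) - usubmx z.
have mid e :
    midpoint (col_mx (usubmx z) (P e)) (col_mx (Q e) (dsubmx z')) = w e.
  rewrite /midpoint add_col_mx subrK addrC subrK -scale_col_mx vsubmxK.
  by rewrite scalerA mulVf ?pnatr_eq0// scale1r.
have P0 : P 0 = dsubmx z.
  rewrite /P w0 /midpoint linearZ linearD/= scalerA mulfV ?pnatr_eq0//.
  by rewrite scale1r addrC addKr.
have Q0 : Q 0 = usubmx z'.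
  rewrite /Q w0 /midpoint linearZ linearD/= scalerA mulfV ?pnatr_eq0//.
  by rewrite scale1r addrK.
have dcoord i := is_derive_coord w 0 i dw.
have dP i : is_derive (0 : R) 1 (fun e => P e i 0)
    (2 * 'D_1 w 0 (rshift _ i) 0).
  have -> : (fun e => P e i 0) =
      2 \*: (fun e => w e (rshift _ i) 0) - cst (dsubmx z' i 0).
    by apply/funext => e; rewrite !mxE.
  by apply: is_derive_eq; rewrite subr0.
have dQ i : is_derive (0 : R) 1 (fun e => Q e i 0)
    (2 * 'D_1 w 0 (lshift _ i) 0).
  have -> : (fun e => Q e i 0) =
      2 \*: (fun e => w e (lshift _ i) 0) - cst (usubmx z i 0).
    by apply/funext => e; rewrite !mxE.
  by apply: is_derive_eq; rewrite subr0.
have derP : derivable P 0 1.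
  by apply/derivable_mxP => i j; rewrite [j]ord1; have [] := dP i.
have derQ : derivable Q 0 1.
  by apply/derivable_mxP => i j; rewrite [j]ord1; have [] := dQ i.
have := st P Q P0 Q0 derP derQ; rewrite /admissible.
under eq_near do rewrite mid.
move=> /(_ wadm); congr (0 <= _).
have -> : (fun e => action (col_mx (usubmx z) (P e))
                           (col_mx (Q e) (dsubmx z'))) =
    2^-1 \*: \sum_i ((fun e => Q e i 0) - cst (usubmx z i 0)) *
           (cst (dsubmx z' i 0) - (fun e => P e i 0)).
  apply/funext => e; rewrite /action !col_mxKu !col_mxKd mxE /= fct_sumE.
  by congr (_ * _); apply: eq_bigr => i _; rewrite !(mxE, fctE).
(* In the product rule the factor 2 in the velocities of [P] and [Q] cancels the one half in the
   action. *)
apply: derive_val; apply: is_derive_eq.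
rewrite /dot [RHS]big_split_ord/= -big_split/= scaler_sumr.
apply: eq_bigr => i _.
rewrite !fctE P0 Q0 !col_mxEu !col_mxEd !mxE /GRing.scale/=.
by field.
Qed.

(** * The discrete equations, for one step and along the trajectory *)

Lemma step_multipliers {R : realType} {n : nat}
    (H : R -> 'cV[R]_n -> 'cV[R]_n -> R)
    (U : set 'cV[R]_((n + 1) + (n + 1))) (s : sense) (c : R)
    (z z' : 'cV[R]_((n + 1) + (n + 1))) (zbar := midpoint z z') :
  open U -> Ck_on 3 U (extH H) -> U zbar ->
  free [:: grad (extH H) zbar; grad (psi H) zbar] ->
  admissible H s c z z' -> stationary_step H s c z z' ->
  exists lambda mu : R,
    [/\ z' - z = lambda *: (Jmx *m grad (extH H) zbar)
                 + mu *: (Jmx *m grad (psi H) zbar),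
        mu * (psi H zbar - c) = 0
      & multiplier_sign s mu].
Proof.
move=> oU C3 Uz fr [H0 bd] st; have [dH _] := C3.
have dpsi := differentiable_psi H U zbar C3 Uz.
have cH : \forall w \near zbar, {for w, continuous (extH H)}.
  apply: filterS (open_nbhs_nbhs (conj oU Uz)) => w.
  by move=> /dH/differentiable_continuous.
(* [free_cons] tests the head against the span of the tail, so the two gradients are first
   swapped. *)
have /andP[y0 x0] : (grad (psi H) zbar \notin <[grad (extH H) zbar]>%VS) &&
    (grad (extH H) zbar != 0).
  have /permPl/perm_free :=
    perm_catC [:: grad (psi H) zbar] [:: grad (extH H) zbar].
  by rewrite /= fr free_cons span_seq1 seq1_free.
(* Recovering the step from its covector means applying [- Jmx], hence the opposite signs of the
   coefficients. *)
have JE lambda mu : action_covector z z' =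
      - lambda *: grad (extH H) zbar - mu *: grad (psi H) zbar ->
    z' - z = lambda *: (Jmx *m grad (extH H) zbar)
             + mu *: (Jmx *m grad (psi H) zbar).
  move=> aE; rewrite -[LHS]opprK -Jmx_action_covector aE mulmxBr -!scalemxAr.
  by rewrite scaleNr opprB opprK addrC.
have aP := stationary_midpoint _ _ _ _ _ _ st.
case: s {st} bd aP => /= bd aP.
- have [w w0 dw wadm|alpha [beta [aE b0 b1]]] := kkt (extH H) (psi H) zbar
    (action_covector z z') c cH (dH _ Uz) dpsi x0 y0 bd.
    by apply: aP => //; move: wadm; rewrite (H0 : extH H zbar = 0).
  exists (- alpha), (- beta); split; rewrite ?oppr_le0 ?mulNr ?b0 ?oppr0//.
  by apply: JE; rewrite opprK scaleNr opprK.
(* An upper bound on [psi] is a lower bound on [- psi]; the change of sign of the gradient makes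
   [mu] equal to [beta] instead of [- beta]. *)
- have [||||w w0 dw wadm|alpha [beta [aE b0 b1]]] :=
    kkt (extH H) (- psi H) zbar (action_covector z z') (- c) cH (dH _ Uz).
  + exact: differentiableN.
  + exact: x0.
  + by rewrite gradN// memvN.
  + by rewrite lerN2.
  + apply: aP => //; apply: filterS wadm => e [-> /=].
    by rewrite lerN2.
  exists (- alpha), beta; split=> //.
  + by apply: JE; rewrite opprK aE gradN// scalerN.
  + by apply/eqP; rewrite -oppr_eq0 -mulrN opprB addrC -b0 opprK.
Qed.

Theorem theorem6 (R : realType) (n N : nat)
    (H : R -> 'cV[R]_n -> 'cV[R]_n -> R)
    (U : set 'cV[R]_((n + 1) + (n + 1)))
    (s : nat -> sense) (psi_ : nat -> R)
    (z : nat -> 'cV[R]_((n + 1) + (n + 1)))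
    (openU : open U)
    (smoothH : Ck_on 3 U (extH H))
    (zU : forall k : nat, (k < N)%N -> U (midpoint (z k) (z k.+1)))
    (indep : forall k : nat, (k < N)%N ->
       free [:: grad (extH H) (midpoint (z k) (z k.+1));
                grad (psi H) (midpoint (z k) (z k.+1))])
    (DTH : regularized_DTH H N s psi_ z) :
  exists lambda mu : nat -> R, forall k : nat, (k < N)%N ->
    let zbar := midpoint (z k) (z k.+1) in
    [/\ z k.+1 - z k = lambda k *: (Jmx *m grad (extH H) zbar)
                       + mu k *: (Jmx *m grad (psi H) zbar),
        extH H zbar = 0,
        bound (s k) (psi H zbar) (psi_ k),
        mu k * (psi H zbar - psi_ k) = 0
      & multiplier_sign (s k) (mu k)].
Proof.
have /choice[lm lmP] : forall k, exists lm : R * R, (k < N)%N ->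
    let zbar := midpoint (z k) (z k.+1) in
    [/\ z k.+1 - z k = lm.1 *: (Jmx *m grad (extH H) zbar)
                       + lm.2 *: (Jmx *m grad (psi H) zbar),
        lm.2 * (psi H zbar - psi_ k) = 0
      & multiplier_sign (s k) lm.2].
  (* Beyond the last step the multipliers are set to 0, which lets choice range over all [k]. *)
  move=> k; have [kN|] := boolP (k < N)%N; last by exists (0, 0).
  have [adm st] := DTH k kN.
  have [lambda [mu lmP]] := step_multipliers H U (s k) (psi_ k) _ _ openU
    smoothH (zU k kN) (indep k kN) adm st.
  by exists (lambda, mu).
exists (fun k => (lm k).1), (fun k => (lm k).2) => k kN zbar.
have [dz comp sgn] := lmP k kN.
by have [[H0 bd] _] := DTH k kN.
Qed.
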